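(* For each sequential recursive algorithm $\mathcal{R}$ there exists a recursive Abstract State Machine which is equivalent to $\mathcal{R}$ with respect to recursive runs.
   Context: Signatures and states. A signature $\Sigma$ is a finite set of function symbols with arities. A state over $\Sigma$ is a structure with a base set $B$ containing $\mathit{undef}$ and interpretations $f_S:B^{\mathrm{ar}(f)}\to B$ of the symbols. A location is a pair $(f,(a_1,\dots,a_n))$, and an update is a pair (location, value). An update set is consistent if it contains no two distinct values for the same location. For a consistent update set $\Delta$, $S+\Delta$ is $S$ with the updates applied. $\Delta(S,S')$ denotes the minimal consistent update set with $S+\Delta(S,S')=S'$. Non-deterministic sequential (nd-seq) algorithms. An nd-seq algorithm has states $\mathcal{S}$ over $\Sigma$, initial states $\mathcal{I}\subseteq\mathcal{S}$, and a transition relation $\tau\subseteq\mathcal{S}\times\mathcal{S}$, subject to the following conditions. - $\mathcal{S}$ and $\mathcal{I}$ are isomorphism-closed. - Transitions preserve the base set and commute with isomorphisms. - Bounded exploration: there is a finite set $W$ of ground terms such that states with the same base set agreeing on $W$ have the same set of update sets $\boldsymbol{\Delta}(S)=\{\Delta(S,S')\mid\tau(S,S')\}$. i/o-algorithms. An i/o-algorithm is an nd-seq algorithm, possibly with call steps, with signature $\Sigma_{in}\sqcup\Sigma_{loc}\sqcup\Sigma_{out}$. It never updates its input locations and never reads its output locations. Its local and output locations are $\mathit{undef}$ in initial states. Call relationship. A parent $\mathcal{A}^p$ and child $\mathcal{A}^c$ stand in the call relationship when: - $\Sigma^c_{in}\subseteq\Sigma^p$, and these locations are written but never read by the parent; -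 $\Sigma^c_{out}\subseteq\Sigma^p$, and these locations are read but never written by the parent; - $\Sigma^c_{loc}\cap\Sigma^p=\emptyset$. Call step postulate. A call activates fresh instances of finitely many callees. Instances have disjoint, agent-labelled local symbols, and their i/o symbols are shared with the caller. Each callee's initial state is determined by the caller's input alone. Callees compute independently, the caller waits until all callees have terminated, and each callee returns output in its final state. Sequential recursive algorithms. A sequential recursive algorithm is a finite set of i/o-algorithms with a distinguished main component. Recursive runs of a sequential recursive algorithm. An instance is Active if it has been called (or is main) and has not terminated. An instance is Waiting if some instance it called is Active. A recursive run is a sequence of states $S_0,S_1,\dots$ with finite sets $C_0,C_1,\dots$ of instances such that: - $C_0=\{\mathit{main}\}$; - each $C_i$ consists of Active, non-Waiting instances; - $S_{i+1}$ is obtained from $S_i$ by simultaneously performing one step of each instance in $C_i$. In addition, a fixed $m>0$ bounds the number of callees per call step. Recursive ASMs. Recursive ASM rules are built inductively from the following constructs: - assignments $f(t_1,\dots,t_n):=t_0$; - $\texttt{IF}$, $\texttt{PAR}$ (bounded parallel composition) and $\texttt{CHOOSE}$ (bounded choice); - $\texttt{LET }x=t\texttt{ IN }r$; - call rules $t_0\leftarrow N(t_1,\dots,t_n)$ for a named rule declared by $N(x_1,\dots,x_n)=r$. A recursive ASM is a finite set of such rules, one of which is main. Semantics of call rules. Executing $t_0\leftarrow N(t_1,\dots,t_n)$ performs the following: - create a new agent $c$ in $\mathit{CalledBy}(\mathit{self})$; - set $\mathit{pgm}(c)$ to an instance $\mathbf{amb}\ c\ \mathbf{in}\ q$ of the declared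 body $q$, whose local functions are parameterized by $c$; - initialize $c$'s state with the caller-evaluated inputs and the caller-evaluated output location $t_0$; - set $\mathit{CalledBy}(c)=\emptyset$. Recursive runs of a recursive ASM. An agent is Active if its program has not terminated. An agent is Waiting if some agent it called is Active. A recursive run is a sequence of states $S_0,S_1,\dots$ with finite agent sets $A_0,A_1,\dots$ such that: - $A_0=\{a_0\}$ with $\mathit{pgm}(a_0)=\mathbf{amb}\ a_0\ \mathbf{in}\ \mathit{main}$; - each $A_i$ consists of Active, non-Waiting agents; - $S_{i+1}$ results from one step of $\mathit{pgm}(a)$ for each $a\in A_i$.
   Formalization: Bounded exploration is required also for states with different base sets (else ''c := any element'' is a counterexample); call rules may have one output term per output symbol of the callee and may pass input functions by reference, not only t_0 ← N(t_1,…,t_n). *)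

(* Defs.v *)
(* MathComp / MathComp classical sets. *)
From mathcomp Require Import all_boot.
From mathcomp Require Import boolp classical_sets functions cardinality.

Set Implicit Arguments.
Unset Strict Implicit.
Unset Printing Implicit Defensive.

Local Open Scope classical_set_scope.

(* Base sets are subsets of a universe U; [point : U] plays the role of undef. *)

Definition symbol := (nat * nat)%type.
Definition arity (f : symbol) : nat := f.2.

Section Structures.
Variable U : pointedType.

Record structure (F : Type) := Structure {
  base : set U;
  interp : F -> seq U -> U }.

Definition in_base (F : Type) (S : structure F) (s : seq U) : Prop :=
  forall x, x \in s -> base S x.

(* Interpretations are total on [seq U]; fixing the junk values to undef makes
   equality of structures the equality of states over [Sg]. *)
Record state_over (Sg : seq symbol) (S : structure symbol) : Prop := {
  base_undef : base S point;
  interp_base : forall f args, f \in Sg -> size args = arity f ->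
    in_base S args -> base S (interp S f args);
  interp_junk : forall f args,
    ~ (f \in Sg /\ size args = arity f /\ in_base S args) ->
    interp S f args = point }.

Definition location (F : Type) := (F * seq U)%type.
Definition update (F : Type) := (location F * U)%type.

Definition consistent (F : Type) (D : set (update F)) : Prop :=
  forall l v w, D (l, v) -> D (l, w) -> v = w.

(* S' = S + D; no S' satisfies this when D is inconsistent. *)
Record adds_to (F : Type) (S : structure F) (D : set (update F))
    (S' : structure F) : Prop := {
  adds_base : base S' = base S;
  adds_updated : forall f args v, D ((f, args), v) -> interp S' f args = v;
  adds_frame : forall f args, (forall v, ~ D ((f, args), v)) ->
    interp S' f args = interp S f args }.

Definition diff (F : Type) (S S' : structure F) : set (update F) :=
  [set u | interp S' u.1.1 u.1.2 = u.2 /\ interp S u.1.1 u.1.2 <> u.2].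

Lemma adds_to_consistent F (S S' : structure F) D :
  adds_to S D S' -> consistent D.
Proof.
by move=> [_ up _] [f args] v w /up <- /up <-.
Qed.

Lemma diff_adds_to F (S S' : structure F) :
  base S' = base S -> adds_to S (diff S S') S'.
Proof.
move=> bE; split=> // [f args v [] //|f args nD].
apply: contrapT => ne; apply: (nD (interp S' f args)); split=> //=.
by move=> e; apply: ne.
Qed.

Lemma diff_minimal F (S S' : structure F) D :
  adds_to S D S' -> diff S S' `<=` D.
Proof.
move=> [_ up fr] [[f args] v] [/= e ne].
apply: contrapT => nD; apply: ne; rewrite -e fr // => w Dw; apply: nD.
by rewrite -e (up _ _ _ Dw).
Qed.

Record isomorphism (s : U -> U) (S T : structure symbol) : Prop := {
  iso_undef : s point = point;
  iso_inj : forall x y, base S x -> base S y -> s x = s y -> x = y;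
  iso_base : base T = s @` base S;
  iso_interp : forall f args, in_base S args ->
    interp T f (map s args) = s (interp S f args) }.

Definition iso_closed (Sg : seq symbol) (X : set (structure symbol)) : Prop :=
  forall s S T, X S -> state_over Sg T -> isomorphism s S T -> X T.

(* Variables occur only in ASM rules. *)
Inductive term :=
  | Var of nat
  | Undef
  | App of symbol & seq term.

Fixpoint eval (S : structure symbol) (e : nat -> U) (t : term) : U :=
  match t with
  | Var x => e x
  | Undef => point
  | App f ts => interp S f [seq eval S e u | u <- ts]
  end.

Definition no_env : nat -> U := fun=> point.

(* Well-formed over [Sg] with variables in [xs]; ground when [xs = [::]]. *)
Fixpoint term_over (xs : seq nat) (Sg : seq symbol) (t : term) : bool :=
  match t with
  | Var x => x \in xs
  | Undef => true
  | App f ts => [&& f \in Sg, size ts == arity f & all (term_over xs Sg) ts]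
  end.

Record io_signature := IOSignature {
  s_in : seq symbol;
  s_loc : seq symbol;
  s_out : seq symbol;
  s_disjoint : uniq (s_in ++ s_loc ++ s_out) }.

Definition s_all (Sg : io_signature) : seq symbol :=
  s_in Sg ++ s_loc Sg ++ s_out Sg.

Section Algorithms.
Variable I : finType. (* component names / rule names *)

(* How an i/o symbol of a callee is connected to its caller.  A nullary input
   symbol may be given a value.  [ByRef f pre] identifies the symbol h of the
   callee with the caller's f curried at [pre]: location h(a) of the callee is
   location f(pre ++ a) of the caller. With pre = [::] the symbol f is shared;
   with h nullary, f(pre) is a single location of the caller. *)
Inductive input_arg :=
  | ByValue of U
  | ByRef of symbol & seq U.

(* c_in and c_out are aligned with s_in and s_out of the callee's signature. *)
Record call := Call {
  callee : I;
  c_in : seq input_arg;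
  c_out : seq (symbol * seq U) }.

Definition map_input_arg (s : U -> U) (i : input_arg) : input_arg :=
  match i with
  | ByValue v => ByValue (s v)
  | ByRef f pre => ByRef f (map s pre)
  end.

Definition map_call (s : U -> U) (d : call) : call :=
  Call (callee d) (map (map_input_arg s) (c_in d))
       [seq (o.1, map s o.2) | o <- c_out d].

Definition arg_symbols (i : input_arg) : seq symbol :=
  if i is ByRef f _ then [:: f] else [::].
Definition arg_values (i : input_arg) : seq U :=
  match i with ByValue v => [:: v] | ByRef _ pre => pre end.

Definition in_symbols (d : call) : seq symbol :=
  flatten (map arg_symbols (c_in d)).
Definition out_symbols (d : call) : seq symbol := map fst (c_out d).
Definition call_values (d : call) : seq U :=
  flatten (map arg_values (c_in d)) ++ flatten (map snd (c_out d)).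

(* [trans S ds S'] is a step from S to S' calling fresh instances of the
   callees listed in ds; ds = [::] for ordinary steps. *)
Record algorithm := Algorithm {
  asig : io_signature;
  states : set (structure symbol);
  initial : set (structure symbol);
  trans : structure symbol -> seq call -> structure symbol -> Prop }.

Definition update_sets (A : algorithm) (S : structure symbol) :
    set (set (update symbol) * seq call) :=
  [set x | exists2 S', trans A S x.2 S' & x.1 = diff S S'].

(* In bounded exploration S and T may have different base sets: restricted to
   equal base sets, the condition would admit "c := any element". *)
Record nd_seq_algorithm (A : algorithm) : Prop := {
  nd_states : forall S, states A S -> state_over (s_all (asig A)) S;
  nd_initial : initial A `<=` states A;
  nd_trans_states : forall S ds S', trans A S ds S' ->
    states A S /\ states A S';
  nd_states_iso : iso_closed (s_all (asig A)) (states A);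
  nd_initial_iso : iso_closed (s_all (asig A)) (initial A);
  nd_trans_base : forall S ds S', trans A S ds S' -> base S' = base S;
  nd_trans_iso : forall s S ds S' T T', trans A S ds S' ->
    state_over (s_all (asig A)) T -> state_over (s_all (asig A)) T' ->
    isomorphism s S T -> isomorphism s S' T' ->
    trans A T (map (map_call s) ds) T';
  nd_bounded_exploration : exists2 W : seq term,
    all (term_over [::] (s_all (asig A))) W &
    forall S T, states A S -> states A T ->
      (forall k t, onth W k = Some t -> eval S no_env t = eval T no_env t) ->
      update_sets A S = update_sets A T }.

Definition never_updates (A : algorithm) (X : seq symbol) : Prop :=
  forall S ds S' f args, trans A S ds S' -> f \in X ->
    interp S' f args = interp S f args.

(* The choice of an update set and of calls does not depend on X.  The update
   set D need not be the minimal one: which updates are trivial in S depends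
   on the values in S of the updated locations themselves. *)
Definition never_reads (A : algorithm) (X : seq symbol) : Prop :=
  forall S T, states A S -> states A T -> base S = base T ->
    (forall f args, f \notin X -> interp S f args = interp T f args) ->
    forall ds S', trans A S ds S' ->
      exists D T', [/\ adds_to S D S', adds_to T D T' & trans A T ds T'].

Definition undef_on (S : structure symbol) (X : seq symbol) : Prop :=
  forall f args, f \in X -> interp S f args = point.

Record io_algorithm (A : algorithm) : Prop := {
  io_nd_seq : nd_seq_algorithm A;
  io_in : never_updates A (s_in (asig A));
  io_out : never_reads A (s_out (asig A));
  io_init : forall S, initial A S ->
    undef_on S (s_loc (asig A)) /\ undef_on S (s_out (asig A)) }.

Definition fits_in (Sp : seq symbol) (h : symbol) (i : input_arg) : bool :=
  match i with
  | ByValue _ => arity h == 0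
  | ByRef f pre => (f \in Sp) && (arity f == size pre + arity h)
  end.

Definition fits_out (Sp : seq symbol) (h : symbol) (o : symbol * seq U) : bool :=
  (o.1 \in Sp) && (arity o.1 == size o.2 + arity h).

(* Local symbols of an instance are labelled by its agent (see [child_link]),
   hence never belong to the signature of the caller. *)
Record call_relationship (P A : algorithm) (d : call) : Prop := {
  cr_in : all2 (fits_in (s_all (asig P))) (s_in (asig A)) (c_in d);
  cr_out : all2 (fits_out (s_all (asig P))) (s_out (asig A)) (c_out d);
  cr_out_inj : uniq (out_symbols d);
  cr_in_unread : never_reads P (in_symbols d);
  cr_out_unwritten : never_updates P (out_symbols d) }.

(* The remaining clauses of the call step postulate (freshness, initial state
   of the callees, waiting) are part of [rec_step] and [rec_run]. *)
Definition call_step_postulate (comp : I -> algorithm) : Prop :=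
  forall p S ds S', trans (comp p) S ds S' ->
    (forall i d, onth ds i = Some d ->
       call_relationship (comp p) (comp (callee d)) d /\
       in_base S (call_values d)) /\
    (* the callees compute independently *)
    (forall i j d d', onth ds i = Some d -> onth ds j = Some d' ->
       forall f, f \in out_symbols d -> f \notin in_symbols d').

Record seq_rec_algorithm := SeqRecAlgorithm {
  component : I -> algorithm;
  sra_main : I;
  sra_io : forall i, io_algorithm (component i);
  sra_call_step : call_step_postulate component;
  sra_bound : exists2 m, 0 < m &
    forall i S ds S', trans (component i) S ds S' -> size ds <= m }.

(* Common layer of recursive runs: the executable behaviour of the instances of
   the named components (of an algorithm or of an ASM). *)

Definition agent := nat.
Definition glocation_prefix := ((agent * symbol) * seq U)%type.

Record instance := Instance {
  iname : I;
  icaller : option agent;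
  ilink : symbol -> glocation_prefix }.

Record gstate := GState {
  gstr : structure (agent * symbol);
  gpgm : agent -> option instance;
  gdone : set agent }.

Record system := System {
  y_main : I;
  y_sig : I -> io_signature;
  y_init : I -> set (structure symbol);
  y_step : I -> structure symbol -> seq call -> structure symbol -> Prop }.

Definition resolve (i : instance) (l : location symbol) :
    location (agent * symbol) :=
  ((ilink i l.1).1, (ilink i l.1).2 ++ l.2).

Definition own_link (a : agent) (h : symbol) : glocation_prefix := ((a, h), [::]).

Definition ref_link (i : instance) (f : symbol) (pre : seq U) :
    glocation_prefix := resolve i (f, pre).

(* Links of the instance c created by a call d of the instance p: local symbols
   and inputs passed by value are labelled with c, the others are those of the
   caller (which may in turn belong to the caller's own caller). *)
Definition child_link (Sg : io_signature) (p : instance) (d : call) (c : agent)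
    (h : symbol) : glocation_prefix :=
  if h \in s_in Sg then
    if onth (c_in d) (index h (s_in Sg)) is Some (ByRef f pre)
    then ref_link p f pre else own_link c h
  else if h \in s_out Sg then
    if onth (c_out d) (index h (s_out Sg)) is Some (f, pre)
    then ref_link p f pre else own_link c h
  else own_link c h.

Section Runs.
Variable Y : system.

Definition view (G : gstate) (i : instance) : structure symbol :=
  Structure (base (gstr G)) (fun h args =>
    if h \in s_all (y_sig Y (iname i))
    then interp (gstr G) (resolve i (h, args)).1 (resolve i (h, args)).2
    else point).

(* No step makes a proper change or a call. *)
Definition final (n : I) (S : structure symbol) : Prop :=
  forall ds S', y_step Y n S ds S' -> ds = [::] /\ S' = S.

Definition called_by (G : gstate) (p c : agent) : Prop :=
  exists2 i, gpgm G c = Some i & icaller i = Some p.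

(* An instance whose callees have not all terminated may be resumed by their
   output, so it has not terminated.  Termination is irrevocable: [D] is the set
   of instances terminated before. *)
Inductive terminated (D : set agent) (G : gstate) : agent -> Prop :=
  | terminated_before a : D a -> terminated D G a
  | terminated_now a i : gpgm G a = Some i -> final (iname i) (view G i) ->
      (forall c, called_by G a c -> terminated D G c) -> terminated D G a.

Definition active (G : gstate) (a : agent) : Prop :=
  (exists i, gpgm G a = Some i) /\ ~ gdone G a.

Definition waiting (G : gstate) (a : agent) : Prop :=
  exists2 c, called_by G a c & active G c.

Definition new_instance (p : agent) (ip : instance) (d : call) (c : agent) :=
  Instance (callee d) (Some p)
    (child_link (y_sig Y (callee d)) ip d c).

(* Initialization of the callee: inputs passed by value are written, output
   locations are undef (a caller may reuse them in several calls). *)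
Definition init_updates (i : instance) (d : call) (c : agent) :
    set (update (agent * symbol)) :=
  [set u | (exists k h v, [/\ onth (s_in (y_sig Y (iname i))) k = Some h,
              onth (c_in d) k = Some (ByValue v) &
              u = (((c, h), [::]), v)]) \/
           (exists h args, [/\ h \in s_out (y_sig Y (iname i)),
              size args = arity h & u = (resolve i (h, args), point)])].

(* One simultaneous step of all a in C: [next a] and [ds a] are the local
   successor state and the calls of a, and [kids a] the fresh agents activated
   for these calls. *)
Definition rec_step (G : gstate) (C : set agent) (G' : gstate) : Prop :=
  exists (next : agent -> structure symbol) (ds : agent -> seq call)
         (kids : agent -> seq agent),
  let kid a k c d := [/\ C a, onth (kids a) k = Some c & onth (ds a) k = Some d] in
  [/\ forall a, C a -> exists i, [/\ gpgm G a = Some i,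
        y_step Y (iname i) (view G i) (ds a) (next a) & size (kids a) = size (ds a)],
      (forall a c, C a -> c \in kids a -> gpgm G c = None) /\
      (forall a, C a -> uniq (kids a)) /\
      (forall a b c, C a -> C b -> c \in kids a -> c \in kids b -> a = b),
      adds_to (gstr G)
        [set u | (exists a i l v, [/\ C a, gpgm G a = Some i,
                    diff (view G i) (next a) (l, v) & u = (resolve i l, v)]) \/
                 (exists a i k c d, [/\ kid a k c d, gpgm G a = Some i &
                    init_updates (new_instance a i d c) d c u])]
        (gstr G'),
      (forall a i k c d, kid a k c d -> gpgm G a = Some i ->
         gpgm G' c = Some (new_instance a i d c) /\
         y_init Y (callee d) (view G' (new_instance a i d c))) /\
      (forall c, (forall a k d, ~ kid a k c d) -> gpgm G' c = gpgm G c) &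
      gdone G' = terminated (gdone G) G'].

Definition a0 : agent := 0.

Definition main_instance : instance := Instance (y_main Y) None (own_link a0).

Definition initial_gstate (G : gstate) : Prop :=
  [/\ gpgm G = (fun a => if a == a0 then Some main_instance else None),
      y_init Y (y_main Y) (view G main_instance),
      forall a f args, ~ (a = a0 /\ f \in s_all (y_sig Y (y_main Y))) ->
        interp (gstr G) (a, f) args = point &
      gdone G = terminated set0 G].

(* C i may be empty for i > 0: finite runs are those that idle from some i on. *)
Record rec_run (G : nat -> gstate) (C : nat -> set agent) : Prop := {
  run_initial : initial_gstate (G 0);
  run_first : C 0 = [set a0];
  run_finite : forall i, finite_set (C i);
  run_enabled : forall i a, C i a -> active (G i) a /\ ~ waiting (G i) a;
  run_step : forall i, rec_step (G i) (C i) (G i.+1) }.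

End Runs.

Definition algorithm_system (R : seq_rec_algorithm) : system :=
  System (sra_main R)
    (fun i => asig (component R i))
    (fun i => initial (component R i))
    (fun i => trans (component R i)).

Inductive cond :=
  | Eq of term & term
  | Neg of cond
  | And of cond & cond.

Fixpoint holds (S : structure symbol) (e : nat -> U) (c : cond) : Prop :=
  match c with
  | Eq t u => eval S e t = eval S e u
  | Neg c => ~ holds S e c
  | And c d => holds S e c /\ holds S e d
  end.

Fixpoint cond_over (xs : seq nat) (Sg : seq symbol) (c : cond) : bool :=
  match c with
  | Eq t u => term_over xs Sg t && term_over xs Sg u
  | Neg c => cond_over xs Sg c
  | And c d => cond_over xs Sg c && cond_over xs Sg d
  end.

Inductive actual :=
  | ValueArg of term
  | RefArg of symbol & seq term.

(* [Par [::]] is skip; [Choose r rs] chooses among r :: rs.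
   [CallRule outs N ins] is the call rule  t_0 <- N(t_1, ..., t_n) ; the
   textbook form is  outs = [:: (f, ts)]  for t_0 = f(ts), and
   ins = [:: ValueArg t_1; ...; ValueArg t_n]; the formal parameters of N are
   its input symbols.  In general there is one entry of [outs] per output
   symbol of N, and [RefArg] passes input functions of positive arity. *)
Inductive rule :=
  | Assign of symbol & seq term & term
  | If of cond & rule & rule
  | Par of seq rule
  | Choose of rule & seq rule
  | Let of nat & term & rule
  | CallRule of seq (symbol * seq term) & I & seq actual.

Definition bind (e : nat -> U) (x : nat) (v : U) : nat -> U :=
  fun y => if y == x then v else e y.

Definition eval_actual (S : structure symbol) (e : nat -> U) (a : actual) :=
  match a with
  | ValueArg t => ByValue (eval S e t)
  | RefArg f ts => ByRef f (map (eval S e) ts)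
  end.

Inductive yields (S : structure symbol) :
    (nat -> U) -> rule -> set (update symbol) -> seq call -> Prop :=
  | yields_assign e f ts t :
      yields S e (Assign f ts t) [set ((f, map (eval S e) ts), eval S e t)] [::]
  | yields_then e c r1 r2 D ds : holds S e c ->
      yields S e r1 D ds -> yields S e (If c r1 r2) D ds
  | yields_else e c r1 r2 D ds : ~ holds S e c ->
      yields S e r2 D ds -> yields S e (If c r1 r2) D ds
  | yields_skip e : yields S e (Par [::]) set0 [::]
  | yields_par e r rs D ds D' ds' : yields S e r D ds ->
      yields S e (Par rs) D' ds' ->
      yields S e (Par (r :: rs)) (D `|` D') (ds ++ ds')
  | yields_choose e r rs k r' D ds : onth (r :: rs) k = Some r' ->
      yields S e r' D ds -> yields S e (Choose r rs) D ds
  | yields_let e x t r D ds : yields S (bind e x (eval S e t)) r D ds ->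
      yields S e (Let x t r) D ds
  | yields_call e outs n ins :
      yields S e (CallRule outs n ins) set0
        [:: Call n (map (eval_actual S e) ins)
                 [seq (o.1, map (eval S e) o.2) | o <- outs]].

Definition actual_over (xs : seq nat) (Sg : seq symbol) (h : symbol) (a : actual) :=
  match a with
  | ValueArg t => (arity h == 0) && term_over xs Sg t
  | RefArg f ts => [&& f \in Sg, arity f == size ts + arity h &
                       all (term_over xs Sg) ts]
  end.

Definition out_over (xs : seq nat) (Sg : seq symbol) (h : symbol)
    (o : symbol * seq term) :=
  [&& o.1 \in Sg, arity o.1 == size o.2 + arity h & all (term_over xs Sg) o.2].

(* Well-formed body of the rule named n with free variables in xs; input
   symbols are not assigned. *)
Fixpoint rule_over (sg : I -> io_signature) (n : I) (xs : seq nat) (r : rule) :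
    bool :=
  let Sg := s_all (sg n) in
  match r with
  | Assign f ts t => [&& f \in s_loc (sg n) ++ s_out (sg n), size ts == arity f,
      all (term_over xs Sg) ts & term_over xs Sg t]
  | If c r1 r2 => [&& cond_over xs Sg c, rule_over sg n xs r1 & rule_over sg n xs r2]
  | Par rs => all (rule_over sg n xs) rs
  | Choose r rs => rule_over sg n xs r && all (rule_over sg n xs) rs
  | Let x t r => term_over xs Sg t && rule_over sg n (x :: xs) r
  | CallRule outs m ins =>
      all2 (out_over xs Sg) (s_out (sg m)) outs &&
      all2 (actual_over xs Sg) (s_in (sg m)) ins
  end.

Record declaration := Declaration {
  d_sig : io_signature;
  d_body : rule;
  d_states : set (structure symbol);
  d_initial : set (structure symbol) }.

Definition rule_step (N : declaration) (S : structure symbol) (ds : seq call)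
    (S' : structure symbol) : Prop :=
  d_states N S /\
  exists2 D, yields S no_env (d_body N) D ds & adds_to S D S'.

(* As usual for ASMs, a declaration comes with an isomorphism-closed set of
   states, closed under the steps of the rule, and one of initial states. *)
Record recursive_asm := RecursiveASM {
  decl : I -> declaration;
  asm_main : I;
  asm_rules : forall n, rule_over (fun m => d_sig (decl m)) n [::] (d_body (decl n));
  asm_states : forall n S, d_states (decl n) S ->
    state_over (s_all (d_sig (decl n))) S;
  asm_states_iso : forall n, iso_closed (s_all (d_sig (decl n))) (d_states (decl n));
  asm_closed : forall n S ds S', rule_step (decl n) S ds S' -> d_states (decl n) S';
  asm_initial : forall n, d_initial (decl n) `<=` d_states (decl n);
  asm_initial_iso : forall n,
    iso_closed (s_all (d_sig (decl n))) (d_initial (decl n));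
  asm_initial_undef : forall n S, d_initial (decl n) S ->
    undef_on S (s_loc (d_sig (decl n))) /\ undef_on S (s_out (d_sig (decl n))) }.

Definition asm_system (M : recursive_asm) : system :=
  System (asm_main M)
    (fun n => d_sig (decl M n))
    (fun n => d_initial (decl M n))
    (fun n => rule_step (decl M n)).

(* The rule named i of M stands for the component i of R. *)
Definition equivalent (R : seq_rec_algorithm) (M : recursive_asm) : Prop :=
  forall G C, rec_run (algorithm_system R) G C <-> rec_run (asm_system M) G C.

End Algorithms.
End Structures.

(* Main.v *)
Require Import Defs.
From mathcomp Require Import all_boot.
From mathcomp Require Import boolp classical_sets functions cardinality.
From mathcomp Require Import zify.

(* In a state of a component, all values occurring in an update or in a call
   are denoted by terms of its bounded exploration witness W: as the universe
   is infinite, any other value v is missed by an injection fixing the values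
   of W, and the copy of the state under it has the same steps but does not
   contain v.  Hence every step is one of finitely many symbolic steps over W,
   and which of these are enabled depends only on the equalities between the
   values of the terms of W (its pattern), since two states with the same
   pattern agree on W up to an injection.  The rule of the component branches
   on the pattern and chooses among the enabled symbolic steps.

   A rule always yields something, so where the component has no transition
   the rule skips.  This does not affect runs: in both systems such a state is
   final, and an active, non-waiting instance is never in a final state. *)

Set Implicit Arguments.
Unset Strict Implicit.
Unset Printing Implicit Defensive.

Local Open Scope classical_set_scope.

(** * Transfer of recursive runs between two systems *)

Section Runs.
Variables (U : pointedType) (I : finType) (main : I) (sig : I -> io_signature).
Variable init : I -> set (structure U symbol).
Implicit Types step : I -> structure U symbol -> seq (call U I) ->
  structure U symbol -> Prop.

Local Notation sys := (System main sig init).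

Lemma terminated_transfer step1 step2 D G a :
  (forall n S, final (sys step1) n S -> final (sys step2) n S) ->
  terminated (sys step1) D G a -> terminated (sys step2) D G a.
Proof.
move=> fin; elim=> [b Db|b i Gb fb _ IH]; first exact: terminated_before.
by apply: terminated_now Gb _ IH; apply: fin.
Qed.

(** All callees of a non-waiting instance have terminated, so with a final view [terminated_now]
    would put the instance into [gdone]. *)
Lemma active_not_final step D G a i : gdone G = terminated (sys step) D G ->
  active G a -> ~ waiting G a -> gpgm G a = Some i ->
  ~ final (sys step) (iname i) (view (sys step) G i).
Proof.
move=> doneE [_ nd] nw Ga fi; apply: nd; rewrite doneE.
apply: terminated_now Ga fi _ => c ac; rewrite -doneE.
by apply: contrapT => ndc; apply: nw; exists c => //; split=> //; case: ac => j; exists j.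
Qed.

(** Steps of a run start from non-final views only, so the two step relations are compared only
    there. Finality must agree everywhere because it determines [gdone]. *)
Lemma rec_run_transfer step1 step2 G C :
  (forall n S, final (sys step1) n S <-> final (sys step2) n S) ->
  (forall n S ds S', ~ final (sys step1) n S ->
    step1 n S ds S' -> step2 n S ds S') ->
  rec_run (sys step1) G C -> rec_run (sys step2) G C.
Proof.
move=> fin imp [[G0 i0 j0 d0] C0 fC en st].
have termE D H : terminated (sys step1) D H = terminated (sys step2) D H.
  by apply/funext => a; apply/propext; split; apply: terminated_transfer => n S /fin.
(* [D] is the preceding [gdone], and empty at the start of the run. *)
have doneE i : exists D, gdone (G i) = terminated (sys step1) D (G i).
  case: i => [|i]; first by exists set0.
  by have [? [? [? [_ _ _ _ dE]]]] := st i; eexists; exact: dE.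
split=> //; first by split=> //; rewrite d0 termE.
move=> i; have [next [ds [kids [h1 h2 h3 h4 h5]]]] := st i.
exists next, ds, kids; split=> //; last by rewrite h5 termE.
move=> a Ca; have [j [Gj sj kj]] := h1 a Ca; exists j; split=> //.
have [D dD] := doneE i; have [aa nw] := en i a Ca.
exact: imp (active_not_final dD aa nw Gj) sj.
Qed.

End Runs.

(** * Injections of the universe *)

(** The injection is a composition of transpositions, one for each index in [l]. *)
Lemma extend_injection (J : eqType) (U : choiceType) (a b : J -> U) (l : seq J) :
  (forall i j, a i = a j <-> b i = b j) ->
  exists2 s : U -> U, injective s & {in l, forall i, s (a i) = b i}.
Proof.
move=> ab; elim: l => [|i l [s s_inj sab]]; first by exists id.
(* The transposition of [s (a i)] and [b i] keeps the values matched so far: if it meets some [b j],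
   the equivalence [ab] forces [a j = a i] and [b j = b i]. *)
pose swap x := if x == s (a i) then b i else if x == b i then s (a i) else x.
have swap_inj : injective swap.
  move=> x y; rewrite /swap.
  case: (x =P s (a i)); case: (x =P b i); case: (y =P s (a i));
    by case: (y =P b i); congruence.
exists (swap \o s); first by move=> x y /swap_inj /s_inj.
move=> j; rewrite inE => /predU1P[->|jl] /=; first by rewrite /swap eqxx.
rewrite /swap sab //; case: eqVneq => [ji|nji].
  by apply/ab/s_inj; rewrite -ji sab.
case: eqVneq => // bij; case/eqP: nji.
by rewrite bij; have /ab <- := bij; rewrite sab.
Qed.

(** Hilbert's hotel: along an injective sequence [e], each [e n] moves to [e n.+1] and all else
    stays, which frees [e 0]. *)
Lemma infinite_shift (U : pointedType) : infinite_set [set: U] ->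
  exists (s : U -> U) (u : U), injective s /\ forall x, s x <> u.
Proof.
move=> /infiniteP/pcard_leP[e].
have e_inj : injective e by move=> m n /(inj (f := e)); rewrite !in_setT; apply.
pose s x := if pselect (exists n, e n = x) is left p then e (sval (cid p)).+1 else x.
exists s, (e 0); split=> [x y|x]; rewrite /s; last first.
  case: pselect => [p /e_inj //|np xE]; apply: np; by exists 0.
case: pselect => [p|np]; case: pselect => [q|nq].
- by move/e_inj => -[]; case: cid => m /= <-; case: cid => n /= <- ->.
- by move=> yE; case: nq; eexists; exact: yE.
- by move=> xE; case: np; eexists; symmetry; exact: xE.
- by [].
Qed.

(** * Isomorphic copies of states under an injection *)

Section Transport.
Variables (U : pointedType) (s : U -> U).
Hypotheses (s_inj : injective s) (s_point : s point = point).

Definition inv_inj (v : U) : U := xget point [set u | s u = v].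

Lemma inv_injK : cancel s inv_inj.
Proof.
by move=> u; apply: s_inj; apply: (@xgetPex _ point [set w | s w = s u]); exists u.
Qed.

(** The test detects arguments in the image of [s]. All others get undef, as [interp_junk]
    demands. *)
Definition transport (S : structure U symbol) : structure U symbol :=
  Structure (s @` base S) (fun f args =>
    if map s (map inv_inj args) == args then s (interp S f (map inv_inj args))
    else point).

Lemma transport_interp S f args :
  interp (transport S) f (map s args) = s (interp S f args).
Proof. by rewrite /= (mapK inv_injK) eqxx. Qed.

Lemma transport_iso S : isomorphism s S (transport S).
Proof. by split=> // [x y _ _ /s_inj //|f args _]; apply: transport_interp. Qed.

Lemma transport_in_base S args :
  in_base (transport S) (map s args) <-> in_base S args.
Proof.
split=> h x.
  by move=> xa; have /= [y Sy /s_inj <-] := h _ (map_f s xa).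
by case/mapP=> y /h Sy ->; exists y.
Qed.

Lemma transport_in_baseE S args : in_base (transport S) args ->
  map s (map inv_inj args) = args.
Proof.
move=> h; rewrite -map_comp; apply: map_id_in => x /h /= [y _ <-].
by rewrite inv_injK.
Qed.

Lemma transport_state Sg S : state_over Sg S -> state_over Sg (transport S).
Proof.
move=> [Su Sb Sj]; split=> [|f args fS sz ba|f args nb].
- by exists point.
- rewrite -(transport_in_baseE ba) transport_interp; exists (interp S f (map inv_inj args)) => //.
  apply: Sb => //; first by rewrite size_map.
  by apply/transport_in_base; rewrite (transport_in_baseE ba).
- rewrite /=; case: eqP => // aE; rewrite Sj // => -[fS [sz ba]]; apply: nb.
  by rewrite -aE !size_map in sz *; split=> //; split=> //; apply/transport_in_base.
Qed.

Lemma transport_eval S t :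
  eval (transport S) (@no_env U) t = s (eval S (@no_env U) t).
Proof.
(* The generated induction principle of [term] says nothing about the arguments of [App], hence the
   explicit fixpoint with an inner induction on the list. *)
move: t; fix IH 1 => -[x||f ts]; [by rewrite /= s_point..|].
have tsE : [seq eval (transport S) (@no_env U) t | t <- ts]
    = map s [seq eval S (@no_env U) t | t <- ts].
  by elim: ts => //= t ts ->; rewrite IH.
rewrite -[LHS]/(interp (transport S) f [seq eval (transport S) (@no_env U) t | t <- ts]).
by rewrite tsE transport_interp.
Qed.

Definition map_update (u : update U symbol) : update U symbol :=
  ((u.1.1, map s u.1.2), s u.2).

(** Outside the image of [s] both copies are undef, so no update arises there; inside it,
    injectivity preserves inequality of values. *)
Lemma transport_diff S S' :
  diff (transport S) (transport S') = map_update @` diff S S'.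
Proof.
apply/seteqP; split=> [[[f args] v] /= [e ne]|_ [[[f args] v] [/= <- ne] <-]].
  move: e ne => /=; case: eqP => // aE <- ne.
  exists ((f, map inv_inj args), interp S' f (map inv_inj args)); last by rewrite /map_update /= aE.
  by split=> //= e; apply: ne; rewrite e.
split; first exact: transport_interp.
by rewrite transport_interp => /s_inj.
Qed.

End Transport.

(** * Symbolic steps and their rules *)

Lemma bseq_onto (X T : Type) (f : X -> T) (b : nat) (s : seq T) :
  size s <= b -> (forall k x, onth s k = Some x -> exists y, f y = x) ->
  exists t : b.-bseq X, map f t = s.
Proof.
move=> sb fs; suff [t tE] : exists t, map f t = s.
  have tb : size t <= b by rewrite -tE size_map in sb.
  by exists (Bseq tb).
elim: s fs {sb} => [|x s IH] fs; first by exists [::].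
have [y <-] := fs 0 x erefl; have [|t <-] := IH; last by exists (y :: t).
by move=> k; exact: (fs k.+1).
Qed.

Lemma yields_par_inv (U : pointedType) (I : finType) (S : structure U symbol)
    e (r : rule I) rs D ds : yields S e (Par (r :: rs)) D ds ->
  exists D1 ds1 D2 ds2, [/\ yields S e r D1 ds1, yields S e (Par rs) D2 ds2,
    D = D1 `|` D2 & ds = ds1 ++ ds2].
Proof. by move=> y; inversion y; do 4!eexists; split; [eassumption..| |]. Qed.

Section Codes.
Variables (U : pointedType) (I : finType) (Sg : seq symbol) (k b m : nat).
Variable tm : 'I_k -> term.

(** Arguments are indices of terms. Arities are not enforced, so some codes decode to ill-formed
    locations. *)
Definition loc_code := (seq_sub Sg * b.-bseq 'I_k)%type.
Definition upd_code := (loc_code * 'I_k)%type.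
Definition call_code := (I * b.-bseq ('I_k + loc_code) * b.-bseq loc_code)%type.
(* Symbolic steps; the bounds [b] and [m] make this a finite type. *)
Definition step_code := ({set upd_code} * m.-bseq call_code)%type.

Definition loc_terms (c : loc_code) : symbol * seq term :=
  (ssval c.1, map tm c.2).

Definition actual_terms (c : 'I_k + loc_code) : actual :=
  match c with
  | inl i => ValueArg (tm i)
  | inr l => RefArg (loc_terms l).1 (loc_terms l).2
  end.

Definition assign_rule (c : upd_code) : rule I :=
  Assign I (loc_terms c.1).1 (loc_terms c.1).2 (tm c.2).

Definition call_rule (c : call_code) : rule I :=
  CallRule (map loc_terms c.2) c.1.1 (map actual_terms c.1.2).

Definition step_rule (c : step_code) : rule I :=
  Par (map assign_rule (enum c.1) ++ map call_rule c.2).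

Section Decode.
Variable S : structure U symbol.
Local Notation ev := (eval S (@no_env U)).

Definition dec_loc (c : loc_code) : location U symbol :=
  ((loc_terms c).1, map ev (loc_terms c).2).

Definition dec_upd (c : upd_code) : update U symbol := (dec_loc c.1, ev (tm c.2)).

Definition dec_arg (c : 'I_k + loc_code) : input_arg U :=
  eval_actual S (@no_env U) (actual_terms c).

Definition dec_call (c : call_code) : call U I :=
  Call c.1.1 (map dec_arg c.1.2) (map dec_loc c.2).

Definition decode (c : step_code) : set (update U symbol) * seq (call U I) :=
  (dec_upd @` [set` c.1], map dec_call c.2).

(** The rule contains no choice, so it has exactly one result. *)
Lemma yields_step_rule c D ds :
  yields S (@no_env U) (step_rule c) D ds <-> (D, ds) = decode c.
Proof.
have assignE u : yields S (@no_env U) (assign_rule u) [set dec_upd u] [::].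
  exact: yields_assign.
have callE d : yields S (@no_env U) (call_rule d) set0 [:: dec_call d].
  suff -> : dec_call d = Call d.1.1
      (map (eval_actual S (@no_env U)) (map actual_terms d.1.2))
      [seq (o.1, map ev o.2) | o <- map loc_terms d.2] by exact: yields_call.
  by rewrite /dec_call -!map_comp.
have detA u D' ds' : yields S (@no_env U) (assign_rule u) D' ds' ->
    D' = [set dec_upd u] /\ ds' = [::] by move=> y; inversion y.
have detC d D' ds' : yields S (@no_env U) (call_rule d) D' ds' ->
    D' = set0 /\ ds' = [:: dec_call d].
  by move=> y; inversion y; rewrite /dec_call -!map_comp.
(* Written with [enum c.1], the claim generalizes to an arbitrary list of updates and is open to
   induction. *)
have decE : decode c = ([set u | exists2 x, x \in enum c.1 & dec_upd x = u],
    map dec_call c.2).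
  congr pair; apply/seteqP; split=> u /= [x xc <-]; exists x => //;
    by rewrite ?mem_enum // -?mem_enum in xc *.
rewrite decE /step_rule; elim: (enum c.1) D ds => [|u us IH] D ds /=; last first.
  split=> [y|[-> ->]].
    have [D1 [ds1 [D2 [ds2 [/detA[-> ->] /IH[-> ->] -> ->]]]]] := yields_par_inv y.
    congr pair.
    apply/seteqP; split=> w /=.
      by case=> [->|[x xu <-]]; [exists u; rewrite ?mem_head|exists x; rewrite ?inE ?xu ?orbT].
    case=> x; rewrite inE => /predU1P[->|xu] <-; first by left.
    by right; exists x.
  have -> : [set w | exists2 x, x \in u :: us & dec_upd x = w] =
      [set dec_upd u] `|` [set w | exists2 x, x \in us & dec_upd x = w].
    apply/seteqP; split=> w /=.
      case=> x; rewrite inE => /predU1P[->|xu] <-; first by left.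
      by right; exists x.
    by case=> [->|[x xu <-]]; [exists u; rewrite ?mem_head|exists x; rewrite ?inE ?xu ?orbT].
  by apply: (@yields_par _ _ _ _ _ _ _ [::]); [exact: assignE|apply/IH].
have -> : [set u | exists2 x, x \in [::] & dec_upd x = u] = set0.
  by apply/seteqP; split=> w // [].
elim: (bseqval c.2) D ds => [|d cs IH] D ds /=.
  by split=> [y|[-> ->]]; [inversion y|exact: yields_skip].
split=> [y|[-> ->]].
  have [D1 [ds1 [D2 [ds2 [/detC[-> ->] /IH[-> ->] -> ->]]]]] := yields_par_inv y.
  by rewrite set0U.
have := yields_par (callE d) (proj2 (IH _ _) erefl).
by rewrite set0U.
Qed.

Definition denoted (v : U) : Prop := exists i, ev (tm i) = v.

Definition coded_loc (l : location U symbol) : Prop :=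
  [/\ l.1 \in Sg, size l.2 <= b & forall v, v \in l.2 -> denoted v].

Definition coded_arg (a : input_arg U) : Prop :=
  match a with
  | ByValue v => denoted v
  | ByRef f pre => coded_loc (f, pre)
  end.

Lemma dec_loc_onto l : coded_loc l -> exists c, dec_loc c = l.
Proof.
case: l => f args [/= fS sz den].
have [|t tE] := @bseq_onto _ _ (ev \o tm) b args sz.
  by move=> j x jx; apply: den; apply/onthP; exists j.
by exists (SeqSub fS, t); rewrite /dec_loc /= -tE -map_comp.
Qed.

Lemma dec_arg_onto a : coded_arg a -> exists c, dec_arg c = a.
Proof.
case: a => [v [i <-]|f pre /dec_loc_onto[c [<- <-]]]; first by exists (inl i).
by exists (inr c).
Qed.

Lemma decode_onto D ds : size ds <= m ->
  (forall l v, D (l, v) -> coded_loc l /\ denoted v) ->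
  (forall j d, onth ds j = Some d ->
    [/\ size (c_in d) <= b, size (c_out d) <= b,
        forall i a, onth (c_in d) i = Some a -> coded_arg a &
        forall i l, onth (c_out d) i = Some l -> coded_loc l]) ->
  exists c, decode c = (D, ds).
Proof.
move=> sz Dok dsok; have [|cs <-] := @bseq_onto _ _ dec_call m ds sz.
  move=> j [n ins outs] /dsok[/= si so oki oko].
  have [|ti <-] := @bseq_onto _ _ dec_arg b ins si.
    by move=> i a /oki /dec_arg_onto.
  have [|to <-] := @bseq_onto _ _ dec_loc b outs so.
    by move=> i a /oko /dec_loc_onto.
  by exists (n, ti, to).
(* All codes that decode into [D] are taken; several codes of one update do no harm. *)
exists ([set c | `[< D (dec_upd c) >]]%SET, cs); congr pair.
apply/seteqP; split=> [_ /= [c +] <-|[l v] Dlv /=]; first by rewrite inE => /asboolP.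
have [/dec_loc_onto[c cE] [i iE]] := Dok _ _ Dlv.
by exists (c, i); [rewrite inE; apply/asboolP|]; rewrite /dec_upd /= cE iE.
Qed.

End Decode.

(** Symbolic steps mention values only through terms, so they commute with any map that carries the
    term values of [S] to those of [T]. *)
Lemma decode_map (s : U -> U) S T c :
  (forall i, eval T (@no_env U) (tm i) = s (eval S (@no_env U) (tm i))) ->
  decode T c = (map_update s @` (decode S c).1, map (map_call s) (decode S c).2).
Proof.
move=> eT.
have locE l : dec_loc T l = ((dec_loc S l).1, map s (dec_loc S l).2).
  by rewrite /dec_loc /= -!map_comp; congr pair; apply: eq_map => i /=.
have argE a : dec_arg T a = map_input_arg s (dec_arg S a).
  case: a => [i|l]; rewrite /dec_arg /=; first by rewrite eT.
  by have [->] := locE l.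
rewrite /decode /=; congr pair.
  by rewrite image_comp; apply: eq_imagel => u _; rewrite /dec_upd /= locE eT.
rewrite -map_comp; apply: eq_map => d; rewrite /dec_call /map_call /=.
by rewrite -!map_comp; congr Call; apply: eq_map.
Qed.

End Codes.

(** * Branching on the equality pattern of the terms *)

Section Dispatch.
Variables (U : pointedType) (I : finType) (k : nat) (tm : 'I_k -> term).
Implicit Types S : structure U symbol.

Definition choice_rule (rs : seq (rule I)) : rule I :=
  if rs is r :: rs' then Choose r rs' else Par [::].

Lemma yields_choice_rule S e rs D ds : yields S e (choice_rule rs) D ds <->
  (exists j r, onth rs j = Some r /\ yields S e r D ds) \/
  [/\ rs = [::], D = set0 & ds = [::]].
Proof.
case: rs => [|r rs] /=; split=> [y|].
- by right; inversion y.
- by case=> [[j [r []]]|[_ -> ->]]; [rewrite onth0n|exact: yields_skip].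
- by left; inversion y; subst; do 2!eexists; split; eassumption.
- by case=> [[j [r' [jr y]]]|[//]]; apply: yields_choose jr y.
Qed.

Definition pattern S : {set 'I_k * 'I_k} :=
  [set ij | eval S (@no_env U) (tm ij.1) == eval S (@no_env U) (tm ij.2)]%SET.

Definition pattern_cond (p : {set 'I_k * 'I_k}) : cond :=
  foldr (fun ij c => And (if ij \in p then Eq (tm ij.1) (tm ij.2)
                          else Neg (Eq (tm ij.1) (tm ij.2))) c)
    (Eq Undef Undef) (enum {: 'I_k * 'I_k}).

Lemma holds_pattern_cond S p :
  holds S (@no_env U) (pattern_cond p) <-> pattern S = p.
Proof.
(* Membership in the full enumeration is kept as a premise so that the induction can run over an
   arbitrary list of pairs. *)
suff -> : holds S (@no_env U) (pattern_cond p) <->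
    {in enum {: 'I_k * 'I_k}, forall ij, (ij \in pattern S) = (ij \in p)}.
  split=> [h|-> //]; apply/setP => ij; apply: h; exact: mem_enum.
rewrite /pattern_cond; elim: (enum _) => [|ij l IH] /=; first by split.
have -> : holds S (@no_env U) (if ij \in p then Eq (tm ij.1) (tm ij.2)
      else Neg (Eq (tm ij.1) (tm ij.2))) <-> (ij \in pattern S) = (ij \in p).
  by rewrite inE; case: (ij \in p); case: eqP => h /=; split=> // /(_ h).
rewrite IH; split=> [[h hl] x|h].
  by rewrite inE => /predU1P[->|/hl].
by split=> [|x xl]; apply: h; rewrite inE ?eqxx ?xl ?orbT.
Qed.

Definition dispatch (br : {set 'I_k * 'I_k} -> rule I) : rule I :=
  foldr (fun p r => If (pattern_cond p) (br p) r) (Par [::])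
    (enum {: {set 'I_k * 'I_k}}).

(** The conditions exclude each other and the enumeration contains every pattern, so exactly the
    branch of [pattern S] is reached and never the closing skip. *)
Lemma yields_dispatch S br D ds : yields S (@no_env U) (dispatch br) D ds <->
  yields S (@no_env U) (br (pattern S)) D ds.
Proof.
rewrite /dispatch; have : pattern S \in enum {: {set 'I_k * 'I_k}} by rewrite mem_enum.
elim: (enum _) => //= p l IH; rewrite inE.
have [pE _|np /= pl] := eqVneq (pattern S) p; last first.
  have nh : ~ holds S (@no_env U) (pattern_cond p).
    by move/holds_pattern_cond/eqP; apply/negP.
  rewrite -(IH pl); split=> [y|]; last exact: yields_else.
  by inversion y.
have h := proj2 (holds_pattern_cond S p) pE; rewrite pE.
split=> [y|]; last exact: yields_then.
by inversion y.
Qed.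

Lemma dispatch_over sg n br : (forall i, term_over [::] (s_all (sg n)) (tm i)) ->
  (forall p, rule_over sg n [::] (br p)) -> rule_over sg n [::] (dispatch br).
Proof.
move=> tm_over br_over; rewrite /dispatch; elim: (enum _) => //= p l ->.
rewrite br_over !andbT /pattern_cond; elim: (enum _) => //= ij l' ->.
by rewrite andbT; case: ifP => _ /=; rewrite !tm_over.
Qed.

End Dispatch.

(** * Facts on aligned lists *)

Lemma all2_mapr_imp (A B X Y : Type) (p : A -> X -> bool) (q : A -> Y -> bool)
    (f : B -> X) (g : B -> Y) s t :
  (forall a c, p a (f c) -> q a (g c)) ->
  all2 p s (map f t) -> all2 q s (map g t).
Proof.
move=> pq; elim: s t => [|a s IH] [|c t] //= /andP[/pq -> /IH ->] //.
Qed.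

Lemma all2_onthr (A X : Type) (p : A -> X -> bool) s t i x :
  all2 p s t -> onth t i = Some x -> exists a, p a x.
Proof.
elim: s t i => [|a s IH] [|y t] [|i] //= /andP[pa ps].
  by case=> <-; exists a.
exact: IH.
Qed.

Lemma all2_size (A X : Type) (p : A -> X -> bool) s t :
  all2 p s t -> size s = size t.
Proof. by elim: s t => [|a s IH] [|y t] //= /andP[_ /IH ->]. Qed.

Lemma mem_flatten_onth (A : Type) (X : eqType) (f : A -> seq X) s i a x :
  onth s i = Some a -> x \in f a -> x \in flatten (map f s).
Proof.
elim: s i => [|a' s IH] [|i] //=; rewrite mem_cat; first by case=> -> ->.
by move=> ia xa; rewrite (IH i) ?orbT.
Qed.

(** * The rule of a single component *)

Section Component.
Variables (U : pointedType) (I : finType) (comp : I -> algorithm U I) (n : I).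
Local Notation A := (comp n).
Local Notation sg := (fun i => asig (comp i)).
Local Notation Sg := (s_all (asig A)).
Hypothesis infU : infinite_set [set: U].
Hypothesis nd : nd_seq_algorithm A.
Hypothesis in_fixed : never_updates A (s_in (asig A)).
Hypothesis calls_ok : forall S ds S', trans A S ds S' ->
  forall i d, onth ds i = Some d ->
    call_relationship A (comp (callee d)) d /\ in_base S (call_values d).
Variables (m b : nat).
Hypothesis calls_bounded : forall S ds S', trans A S ds S' -> size ds <= m.
Hypothesis arity_bounded : forall f, f \in Sg -> arity f <= b.
Hypothesis io_bounded :
  forall i, size (s_in (sg i)) <= b /\ size (s_out (sg i)) <= b.
Variable W : seq term.
Hypothesis W_over : all (term_over [::] Sg) W.
Hypothesis W_explores : forall S T, states A S -> states A T ->
  (forall k t, onth W k = Some t ->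
     eval S (@no_env U) t = eval T (@no_env U) t) ->
  update_sets A S = update_sets A T.

(* [Undef] is added since undef, too, is fixed by all isomorphisms. *)
Definition tm (i : 'I_(size W).+1) : term := nth Undef (Undef :: W) i.

Lemma tm_over i : term_over [::] Sg (tm i).
Proof.
rewrite /tm; case: i => -[|i] //=; rewrite ltnS => iW.
exact: (all_nthP Undef W_over).
Qed.

Lemma agree_update_sets S T : states A S -> states A T ->
  (forall i, eval S (@no_env U) (tm i) = eval T (@no_env U) (tm i)) ->
  update_sets A S = update_sets A T.
Proof.
move=> sS sT ST; apply: W_explores => // j t jt.
have jW : j < size W by rewrite -onthTE jt.
(* Index 0 of [tm] is [Undef], so entry [j] of [W] has index [j.+1]. *)
by have := ST (Ordinal (jW : j.+1 < (size W).+1)); rewrite /tm /= (onth_nth _ _ _ _ jt).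
Qed.

Lemma transport_states s S : injective s -> s point = point ->
  states A S -> states A (transport s S).
Proof.
move=> si s0 sS; apply: (nd_states_iso nd sS); last exact: transport_iso.
exact: transport_state (nd_states nd sS).
Qed.

Lemma transport_update_sets s S D ds : injective s -> s point = point ->
  update_sets A S (D, ds) ->
  update_sets A (transport s S) (map_update s @` D, map (map_call s) ds).
Proof.
move=> si s0 [S' /= tr ->]; exists (transport s S'); last by rewrite /= transport_diff.
have [sS sS'] := nd_trans_states nd tr.
apply: (nd_trans_iso nd tr); try exact: transport_iso;
  exact/(transport_state si s0)/(nd_states nd).
Qed.

(** Ill-formed locations are undef in both states, so no update occurs there. *)
Lemma step_diff S ds S' f args v :
  trans A S ds S' -> diff S S' ((f, args), v) ->
  [/\ f \in Sg, size args = arity f, in_base S args & base S v].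
Proof.
move=> tr [/= e ne]; have [sS sS'] := nd_trans_states nd tr.
have bE := nd_trans_base nd tr.
have [_ _ junk] := nd_states nd sS; have [_ ib junk'] := nd_states nd sS'.
have in_baseE : in_base S' args <-> in_base S args by rewrite /in_base bE.
have [fS [sz ba]] : f \in Sg /\ size args = arity f /\ in_base S args.
  apply: contrapT => nj; apply: ne; rewrite junk // -e junk' //.
  by case=> fS [sz /in_baseE ba]; apply: nj.
by split=> //; rewrite -bE -e; apply: ib => //; apply/in_baseE.
Qed.

(** [T] is the copy of [S] under an injection that fixes all denoted values and misses [v]. It
    agrees with [S] on [W], hence has the same update sets, although its base set may differ. *)
Lemma undenoted_avoided S ds S' v : trans A S ds S' -> ~ denoted tm S v ->
  exists T T', [/\ trans A T ds T', diff S S' = diff T T' & ~ base T v].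
Proof.
move=> tr nv; have [sS _] := nd_trans_states nd tr.
have [s0 [u [s0_inj s0u]]] := infinite_shift infU.
(* After the shift [s0], which misses [u], the map [p] returns the term values to their places and
   sends [u] to [v]; thus [p \o s0] misses [v]. The index [None] stands for the pair of [u] and
   [v]. *)
pose src (o : option 'I_(size W).+1) :=
  if o is Some i then s0 (eval S (@no_env U) (tm i)) else u.
pose tgt (o : option 'I_(size W).+1) :=
  if o is Some i then eval S (@no_env U) (tm i) else v.
have [|p p_inj pE] := @extend_injection _ _ src tgt (enum {: option 'I_(size W).+1}).
  case=> [i|] [j|] //=; split=> //.
  - exact: s0_inj.
  - by move=> ->.
  - by move/s0u.
  - by move=> e; case: nv; exists i.
  - by move/esym/s0u.
  - by move=> e; case: nv; exists j.
pose s x := p (s0 x).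
have s_inj : injective s by move=> x y /p_inj /s0_inj.
have s_fix i : s (eval S (@no_env U) (tm i)) = eval S (@no_env U) (tm i).
  by have := pE (Some i) (mem_enum _ _).
have s_pt : s point = point by have := s_fix ord0.
have : update_sets A S (diff S S', ds) by exists S'.
rewrite (@agree_update_sets S (transport s S)) //; last 2 first.
- exact: transport_states.
- by move=> i; rewrite transport_eval.
case=> T' /= trT dE; exists (transport s S), T'; split=> // -[y _] /= yv.
have := pE None (mem_enum _ _); rewrite /= -yv /s => /p_inj /esym; exact: s0u.
Qed.

(** Otherwise the same update would occur in a state whose base set lacks one of its values. *)
Lemma diff_denoted S ds S' f args v : trans A S ds S' ->
  diff S S' ((f, args), v) ->
  denoted tm S v /\ forall x, x \in args -> denoted tm S x.
Proof.
move=> tr d; split=> [|x xa]; apply: contrapT => nx;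
  have [T [T' [trT dE nT]]] := undenoted_avoided tr nx;
  by rewrite dE in d; have [_ _ ba bv] := step_diff trT d; apply: nT => //; exact: ba.
Qed.

Lemma call_denoted S ds S' i d x : trans A S ds S' -> onth ds i = Some d ->
  x \in call_values d -> denoted tm S x.
Proof.
move=> tr id xd; apply: contrapT => nx.
have [T [T' [trT _ nT]]] := undenoted_avoided tr nx.
by have [_ /(_ x xd)] := calls_ok trT id.
Qed.

Local Notation code := (step_code I Sg (size W).+1 b m).

Lemma step_decode S D ds : update_sets A S (D, ds) ->
  exists c : code, decode tm S c = (D, ds).
Proof.
case=> S' /= tr DE; apply: decode_onto; first exact: calls_bounded tr.
  move=> [f args] v; rewrite DE => d.
  have [fS sz _ _] := step_diff tr d; have [dv da] := diff_denoted tr d.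
  by split=> //; split=> //=; rewrite sz arity_bounded.
move=> j d jd; have [rel _] := calls_ok tr jd.
have den x := call_denoted (x := x) tr jd.
have [bi bo] := io_bounded (callee d).
split.
- by rewrite -(all2_size (cr_in rel)).
- by rewrite -(all2_size (cr_out rel)).
- move=> i a ia; have [h] := all2_onthr (cr_in rel) ia.
  have {}den x : x \in arg_values a -> denoted tm S x.
    by move=> xa; apply: den; rewrite mem_cat (mem_flatten_onth ia xa).
  case: a den {ia} => [v|f pre] den /=; first by move=> _; apply: den; rewrite mem_head.
  case/andP=> fS /eqP aE; split=> //=.
  (* The curried prefix is no longer than the arity of the caller's symbol. *)
  by apply: leq_trans (arity_bounded fS); rewrite aE leq_addr.
- move=> i [f pre] il; have [h /andP[/= fS /eqP aE]] := all2_onthr (cr_out rel) il.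
  split=> //=; first by apply: leq_trans (arity_bounded fS); rewrite aE leq_addr.
  by move=> x xp; apply: den; rewrite mem_cat (mem_flatten_onth (f := snd) il xp) orbT.
Qed.

(** Equal patterns give an injection carrying the term values of [S] to those of [T]; the copy of
    [S] under it agrees with [T] on [W]. *)
Lemma pattern_step S T (c : code) : states A S -> states A T ->
  pattern tm S = pattern tm T ->
  update_sets A S (decode tm S c) -> update_sets A T (decode tm T c).
Proof.
move=> sS sT pE upd.
have [i j|s s_inj sE] := @extend_injection _ _
    (fun i => eval S (@no_env U) (tm i)) (fun i => eval T (@no_env U) (tm i))
    (enum 'I_(size W).+1).
  have /setP/(_ (i, j)) := pE; rewrite !inE /= => ijE.
  by split=> /eqP; [rewrite ijE|rewrite -ijE] => /eqP.
have {}sE i : eval T (@no_env U) (tm i) = s (eval S (@no_env U) (tm i)).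
  by rewrite sE // mem_enum.
have s_pt : s point = point by have := sE ord0.
rewrite (decode_map c sE) -(@agree_update_sets (transport s S)) //.
- by apply: transport_update_sets => //; case: (decode _ _ _) upd.
- exact: transport_states.
- by move=> i; rewrite transport_eval // sE.
Qed.

(** One state realizing the step suffices: by [pattern_step] it is then enabled in all states with
    pattern [p]. *)
Definition pattern_codes (p : {set 'I_(size W).+1 * 'I_(size W).+1}) : seq code :=
  [seq c <- enum {: code} |
    `[< exists S, [/\ states A S, pattern tm S = p &
                     update_sets A S (decode tm S c)] >]].

Definition body : rule I :=
  dispatch tm (fun p => choice_rule (map (step_rule tm) (pattern_codes p))).

Lemma mem_pattern_codes S c : states A S ->
  (c \in pattern_codes (pattern tm S)) = `[< update_sets A S (decode tm S c) >].
Proof.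
move=> sS; rewrite mem_filter mem_enum andbT; apply: asbool_equiv_eq; split.
  by case=> T [sT pE]; apply: pattern_step.
by exists S.
Qed.

(** The second alternative is the skip: every transition has a code, so the list of codes is empty
    exactly when there is no transition. *)
Lemma yields_body S D ds : states A S ->
  yields S (@no_env U) body D ds <->
  update_sets A S (D, ds) \/
  [/\ update_sets A S = set0, D = set0 & ds = [::]].
Proof.
move=> sS; rewrite yields_dispatch yields_choice_rule; split=> [[[j [r []]]|]|[]].
- rewrite onth_map; case jc : (onth _ j) => [c|] //= [<-] /yields_step_rule ->.
  left; have : c \in pattern_codes (pattern tm S) by apply/onthP; exists j.
  by rewrite mem_pattern_codes // => /asboolP.
- case=> nil -> ->; right; split=> //; apply/seteqP; split=> // -[D' ds'] upd.
  have [c cE] := step_decode upd.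
  have : c \in pattern_codes (pattern tm S).
    by rewrite mem_pattern_codes //; apply/asboolP; rewrite cE.
  by case: pattern_codes nil.
- move=> upd; left; have [c cE] := step_decode upd.
  have /onthP[j jc] : c \in pattern_codes (pattern tm S).
    by rewrite mem_pattern_codes //; apply/asboolP; rewrite cE.
  exists j, (step_rule tm c); rewrite onth_map jc; split=> //.
  by apply/yields_step_rule.
- case=> none -> ->; right; split=> //.
  case E : (pattern_codes _) => [//|c l].
  have : c \in pattern_codes (pattern tm S) by rewrite E mem_head.
  by rewrite mem_pattern_codes // none => /asboolP.
Qed.

(** An arbitrary code may violate arities or assign inputs; one realized by an actual step inherits
    well-formedness from it. *)
Lemma step_rule_over S (c : code) : update_sets A S (decode tm S c) ->
  rule_over sg n [::] (step_rule tm c).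
Proof.
case=> S' /= tr dE.
have all_tm (l : seq 'I_(size W).+1) : all (term_over [::] Sg) (map tm l).
  by rewrite all_map; apply/allP => i _ /=; exact: tm_over.
have locE (l : loc_code Sg (size W).+1 b) h :
    fits_out Sg h (dec_loc tm S l) -> out_over [::] Sg h (loc_terms tm l).
  by rewrite /fits_out /out_over /= size_map all_tm andbT.
rewrite all_cat !all_map; apply/andP; split.
  apply/allP => u; rewrite mem_enum => uc /=.
  have d : diff S S' (dec_upd tm S u) by rewrite -dE; exists u.
  have := d; rewrite /dec_upd /dec_loc => /(step_diff tr)[/= fS sz _ _].
  rewrite size_map in sz; rewrite sz eqxx all_tm tm_over !andbT.
  (* An input symbol is excluded: the update is a proper change, which [in_fixed] forbids. *)
  move: fS; rewrite mem_cat => /orP[fin|//]; case: d => /= e; case.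
  by rewrite -(in_fixed _ tr fin) e.
apply/allP => d /onthP[i id] /=.
have id' : onth (map (dec_call tm S) c.2) i = Some (dec_call tm S d).
  by rewrite onth_map id.
have [[cin cout _ _ _] _] := calls_ok tr id'; apply/andP; split.
  by apply: all2_mapr_imp cout => h l; exact: locE.
apply: all2_mapr_imp cin => h [j|l] /=; first by rewrite tm_over andbT.
exact: locE.
Qed.

Lemma body_over : rule_over sg n [::] body.
Proof.
apply: dispatch_over => [|p]; first exact: tm_over.
have : all (rule_over sg n [::]) (map (step_rule tm) (pattern_codes p)).
  rewrite all_map; apply/allP => c; rewrite mem_filter => /andP[/asboolP[S [_ _ upd]] _].
  exact: step_rule_over upd.
by case: (map _ _).
Qed.

End Component.

(** * Assembly of the recursive ASM and equivalence of runs *)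

Lemma component_rule (U : pointedType) (infU : infinite_set [set: U])
    (I : finType) (R : seq_rec_algorithm U I) n :
  exists r : rule I, rule_over (fun i => asig (component R i)) n [::] r /\
  forall S D ds, states (component R n) S ->
    (yields S (@no_env U) r D ds <->
     update_sets (component R n) S (D, ds) \/
     [/\ update_sets (component R n) S = set0, D = set0 & ds = [::]]).
Proof.
pose sg i := asig (component R i).
have [nd in_fixed _ _] := sra_io R n; have [m _ calls_bounded] := sra_bound R.
have [W W_over W_explores] := nd_bounded_exploration nd.
have calls_ok S ds S' (tr : trans (component R n) S ds S') i d (id : onth ds i = Some d) :=
  proj1 (sra_call_step tr) i d id.
(* A sum serves as a common bound for argument lists of locations and parameter lists of all
   callees. *)
pose b := \sum_(f <- s_all (sg n)) arity f +
  \sum_i (size (s_in (sg i)) + size (s_out (sg i))).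
have arity_bounded f : f \in s_all (sg n) -> arity f <= b.
  by move=> fS; rewrite /b (big_rem f) //= -!addnA leq_addr.
have io_bounded i : size (s_in (sg i)) <= b /\ size (s_out (sg i)) <= b.
  by rewrite /b (bigD1 i) //=; split; lia.
exists (body (component R) n m b W); split; first exact: body_over.
by move=> S D ds; apply: yields_body => // S0 ds0 S0'; apply: calls_bounded.
Qed.

Lemma adds_to_inj (U : pointedType) (F : Type) (S S1 S2 : structure U F) D :
  adds_to S D S1 -> adds_to S D S2 -> S1 = S2.
Proof.
case: S1 S2 => [B1 i1] [B2 i2] [/= -> up1 fr1] [/= -> up2 fr2]; congr Structure.
apply/funext => f; apply/funext => args.
have [[v Dv]|nD] := pselect (exists v, D ((f, args), v)).
  by rewrite (up1 _ _ _ Dv) (up2 _ _ _ Dv).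
by rewrite fr1 ?fr2 // => v Dv; apply: nD; exists v.
Qed.

Theorem theorem2 (U : pointedType) (infU : infinite_set [set: U]%classic)
    (I : finType) (R : seq_rec_algorithm U I) :
  exists M : recursive_asm U I, equivalent R M.
Proof.
have [r rP] := choice (component_rule infU R).
pose dc n := Declaration (asig (component R n)) (r n) (states (component R n))
  (initial (component R n)).
have nd n := io_nd_seq (sra_io R n).
(* The rule makes the transitions of the component and, where there are none, an idle step. *)
have stepE n S ds S' : rule_step (dc n) S ds S' <->
    trans (component R n) S ds S' \/
    [/\ states (component R n) S, update_sets (component R n) S = set0,
        ds = [::] & S' = S].
  split=> [[/= sS [D /(proj2 (rP n) _ _ _ sS) yD add]]|].
    case: yD => [[S1 /= tr DE]|[none D0 ->]].
      left; suff -> : S' = S1 by [].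
      by apply: adds_to_inj add _; rewrite DE; apply: diff_adds_to; apply: nd_trans_base tr.
    by right; split=> //; apply: adds_to_inj add _; rewrite D0; split.
  case=> [tr|[sS none -> ->]].
    have [sS _] := nd_trans_states (nd n) tr; split=> //.
    exists (diff S S'); last by apply: diff_adds_to; apply: nd_trans_base tr.
    by apply/(proj2 (rP n)) => //; left; exists S'.
  split=> //; exists set0; last by split.
  by apply/(proj2 (rP n)) => //; right.
have closed n S ds S' : rule_step (dc n) S ds S' -> states (component R n) S'.
  by move=> /stepE[/(nd_trans_states (nd n))[]|[sS _ _ ->]].
exists (@RecursiveASM U I dc (sra_main R) (fun n => proj1 (rP n))
  (fun n => @nd_states _ _ _ (nd n)) (fun n => nd_states_iso (nd n)) closed
  (fun n => @nd_initial _ _ _ (nd n)) (fun n => nd_initial_iso (nd n))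
  (fun n => @io_init _ _ _ (sra_io R n))).
pose step1 n := trans (component R n); pose step2 n := rule_step (dc n).
pose sys := @System U I (sra_main R) (fun n => asig (component R n))
  (fun n => initial (component R n)).
(* Idle steps call nothing and change nothing, so they do not affect finality. *)
have finE n S : final (sys step1) n S <-> final (sys step2) n S.
  split=> fin ds S' /= st; last by apply: fin; apply/stepE; left.
  by case/stepE: st => [/fin //|[]].
have nfin n S : ~ final (sys step1) n S -> update_sets (component R n) S <> set0.
  move=> nf none; apply: nf => ds S' /= tr.
  have : set0 (diff S S', ds) by rewrite -none; exists S'.
  by [].
move=> G C; split.
  apply: (@rec_run_transfer _ _ _ _ _ step1 step2) => // n S ds S' _ tr.
  by apply/stepE; left.
(* In the converse direction an idle step would require an empty set of update sets, impossible in a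
   non-final state. *)
apply: (@rec_run_transfer _ _ _ _ _ step2 step1) =>
  [n S|n S ds S' nf /stepE[//|[_ none _ _]]].
  by split=> /finE.
by case/nfin: none => /finE.
Qed.
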